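(* Let $X$ be a set of alternatives, let $\Pi$ be a strongly Pos-compatible and consistent permutation process over $X$, and let $f$ be a scoring rule with an associated decreasing weight vector. Then for any nonempty finite set $A\subseteq X$, $f(\Pi(A))=\{a\in A: a\rhd^{pos}_{\Pi}b\ \text{for all } b\in A\}$.
   Context: For a nonempty finite $A\subseteq X$, $S_A$ is the set of bijections $\sigma:A\to\{1,\dots,|A|\}$ (rankings); $\sigma(a)$ is the position of $a$. An anonymous preference profile over $A$ is a probability distribution $\pi$ on $S_A$. A permutation process $\Pi$ over $X$ assigns to each nonempty finite $A\subseteq X$ a probability distribution $\Pi(A)$ on $S_A$ (regarded as a profile over $A$). It is consistent if for all nonempty finite $B\subseteq A\subseteq X$, $\Pi(B)(\sigma')=\sum_{\sigma\in S_A:\sigma|_B=\sigma'}\Pi(A)(\sigma)$ for $\sigma'\in S_B$, where $\sigma|_B\in S_B$ is the ranking of $B$ induced by $\sigma$. Pos-dominance: for a profile $\pi$ over $A$ let $s_j(a)=\sum_{\sigma:\sigma(a)\le j}\pi(\sigma)$; $a\rhd^{pos}_\pi b$ iff $s_j(a)\ge s_j(b)$ for all $j\in\{1,\dots,|A|\}$. For $a,b\in X$, $a\rhd^{pos}_\Pi b$ iff $a\rhd^{pos}_{\Pi(A)}b$ for every finite $A\subseteq X$ containing $a,b$. $\Pi$ is Pos-compatible if for every $A\subseteq X$ the restriction of $\rhd^{pos}_\Pi$ to $A$ is a total preorder (transitive and complete). $\Pi$ is strongly Pos-compatible if it is Pos-compatible and for every nonempty finite $A\subseteq X$, $\rhd^{pos}_{\Pi(A)}$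 equals the restriction of $\rhd^{pos}_\Pi$ to $A$. A scoring rule has, for each size $k$ of the set of alternatives, a weight vector $(\alpha_1,\dots,\alpha_k)$ with $\alpha_i\ge\alpha_{i+1}$ for all $i<k$; for a profile $\pi$ over $A$ with $|A|=k$ it selects the alternatives $a\in A$ maximizing $\sum_{\sigma\in S_A}\pi(\sigma)\,\alpha_{\sigma(a)}$. The weight vector is decreasing if $\alpha_i>\alpha_{i+1}$ for all $i<k$. *)

(* Defs.v *)
From HB Require Import structures.
From mathcomp Require Import all_boot all_order all_algebra finmap.
From mathcomp Require Import boolp classical_sets reals.

Set Implicit Arguments.
Unset Strict Implicit.
Unset Printing Implicit Defensive.

Import Order.TTheory GRing.Theory Num.Theory.

Local Open Scope fset_scope.
Local Open Scope ring_scope.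
Local Open Scope classical_set_scope.

(* Positions are stored 0-based, in 'I_#|`A|; [pos] below is the 1-based
   position used in the mathematics. *)
Record ranking (X : choiceType) (A : {fset X}) : Type := Ranking {
  ranking_val :> {ffun A -> 'I_#|`A|};
  ranking_bij : injectiveb ranking_val && [forall i, i \in codom ranking_val]
}.

HB.instance Definition _ (X : choiceType) (A : {fset X}) :=
  [isSub for @ranking_val X A].
HB.instance Definition _ (X : choiceType) (A : {fset X}) :=
  [Finite of ranking A by <:].

Definition pos (X : choiceType) (A : {fset X}) (s : ranking A) (a : A) : nat :=
  (s a).+1.

Lemma ranking_inj (X : choiceType) (A : {fset X}) (s : ranking A) :
  injective s.
Proof. by apply/injectiveP; case/andP: (ranking_bij s). Qed.

Section Restriction.
Variables (X : choiceType) (A B : {fset X}) (sBA : (B `<=` A)%fset).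
Variable s : ranking A.

Let better (b : B) : {set B} :=
  [set b' : B | (s (fincl sBA b') < s (fincl sBA b))%N]%SET.

Lemma card_better_lt (b : B) : (#|better b| < #|`B|)%N.
Proof.
rewrite cardfE -cardsT; apply: proper_card; apply/properP; split.
  exact: finset.subsetT.
by exists b; rewrite !inE // ltnn.
Qed.

Definition restr_fun : {ffun B -> 'I_#|`B|} :=
  [ffun b => Ordinal (card_better_lt b)].

Lemma restr_fun_lt (b b' : B) :
  (restr_fun b < restr_fun b')%N = (s (fincl sBA b) < s (fincl sBA b'))%N.
Proof.
have mono (c c' : B) : (s (fincl sBA c) <= s (fincl sBA c'))%N ->
    (restr_fun c <= restr_fun c')%N.
  move=> h; rewrite !ffunE /=; apply: subset_leq_card; apply/fintype.subsetP => x.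
  by rewrite !inE => /leq_trans; apply.
case: (ltnP (s (fincl sBA b))) => [lt_bb'|]; last first.
  by move=> /mono; rewrite ltnNge => ->.
rewrite !ffunE /=; apply: proper_card; apply/properP; split.
  by apply/fintype.subsetP => x; rewrite !inE => /ltn_trans; apply.
by exists b; rewrite !inE // ltnn.
Qed.

Lemma restr_fun_bij :
  injectiveb restr_fun && [forall i, i \in codom restr_fun].
Proof.
have inj : injective restr_fun.
  move=> b b' e; apply: (@fincl_inj _ _ _ sBA); apply: (@ranking_inj _ _ s).
  apply/val_inj/eqP; rewrite eqn_leq [X in X && _]leqNgt [X in _ && X]leqNgt.
  by rewrite -!restr_fun_lt e ltnn.
apply/andP; split; first exact/injectiveP.
apply/forallP => i; have := inj_card_onto inj; apply.
by rewrite card_ord cardfE.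
Qed.

Definition restr : ranking B := Ranking restr_fun_bij.

(* [restr] is the ranking of B that orders B as s does. *)
Lemma restr_lt (b b' : B) :
  (pos restr b < pos restr b')%N = (pos s (fincl sBA b) < pos s (fincl sBA b'))%N.
Proof. by rewrite /pos !ltnS; exact: restr_fun_lt. Qed.

End Restriction.

Record profile (R : realType) (X : choiceType) (A : {fset X}) : Type := Profile {
  profile_prob :> ranking A -> R;
  profile_ge0 : forall s, 0 <= profile_prob s;
  profile_sum1 : \sum_(s : ranking A) profile_prob s = 1
}.

(* The value at the empty set carries no information: the empty set has exactly
   one ranking, hence exactly one profile. *)
Definition permutation_process (R : realType) (X : choiceType) : Type :=
  forall A : {fset X}, profile R A.

Section PosDominance.
Variables (R : realType) (X : choiceType).

Definition consistent (Pi : permutation_process R X) : Prop :=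
  forall (A B : {fset X}) (sBA : (B `<=` A)%fset), B != fset0 ->
  forall s' : ranking B,
    Pi B s' = \sum_(s : ranking A | restr sBA s == s') Pi A s.

Definition cum_prob (A : {fset X}) (p : profile R A) (j : nat) (a : A) : R :=
  \sum_(s : ranking A | (pos s a <= j)%N) p s.

Definition pos_dom (A : {fset X}) (p : profile R A) (a b : A) : Prop :=
  forall j : nat, (1 <= j <= #|`A|)%N -> cum_prob p j b <= cum_prob p j a.

Definition pos_dom_process (Pi : permutation_process R X) (a b : X) : Prop :=
  forall (A : {fset X}) (aA : a \in A) (bA : b \in A),
    pos_dom (Pi A) [` aA] [` bA].

Definition total_preorder_on (D : set X) (r : X -> X -> Prop) : Prop :=
  (forall a b c, D a -> D b -> D c -> r a b -> r b c -> r a c) /\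
  (forall a b, D a -> D b -> r a b \/ r b a).

(* The sets D are arbitrary subsets of X, possibly infinite. *)
Definition pos_compatible (Pi : permutation_process R X) : Prop :=
  forall D : set X, total_preorder_on D (pos_dom_process Pi).

Definition strongly_pos_compatible (Pi : permutation_process R X) : Prop :=
  pos_compatible Pi /\
  forall A : {fset X}, A != fset0 ->
  forall a b : A, pos_dom (Pi A) a b <-> pos_dom_process Pi (val a) (val b).

End PosDominance.

(* [weight f i] is the weight of the 1-based position i.+1. *)
Record scoring_rule (R : realType) : Type := ScoringRule {
  weight : forall k : nat, 'I_k -> R;
  weight_noninc : forall (k : nat) (i j : 'I_k), j = i.+1 :> nat ->
    weight j <= weight i
}.

Definition decreasing_weights (R : realType) (f : scoring_rule R) : Prop :=
  forall (k : nat) (i j : 'I_k), j = i.+1 :> nat -> weight f j < weight f i.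

Definition score (R : realType) (f : scoring_rule R) (X : choiceType)
    (A : {fset X}) (p : profile R A) (a : A) : R :=
  \sum_(s : ranking A) p s * weight f (s a).

Definition winners (R : realType) (f : scoring_rule R) (X : choiceType)
    (A : {fset X}) (p : profile R A) : set A :=
  [set a : A | forall b : A, score f p b <= score f p a].

(* Main.v *)
Require Import Defs.
From mathcomp Require Import all_boot all_order all_algebra finmap.
From mathcomp Require Import boolp classical_sets reals.

(** By Abel summation, the score of [a] is a constant plus a combination of the
    cumulative probabilities of [a] whose coefficients are the gaps between
    consecutive weights. Positive gaps make the score strictly monotone for
    Pos-dominance, which strong compatibility makes total on [A]; so the score
    maximizers are the maxima of Pos-dominance. *)

Import Order.TTheory GRing.Theory Num.Theory.

Local Open Scope fset_scope.
Local Open Scope ring_scope.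
Local Open Scope classical_set_scope.

Section Score.
Variables (R : realType) (f : scoring_rule R) (X : choiceType) (A : {fset X}).
Implicit Types (p : profile R A) (a b : A).

Let n := #|`A|.

(* Indexing weights by [nat] (0 out of range) makes the gaps telescope. *)
Definition weight_nat (k i : nat) : R := oapp (@weight R f k) 0 (insub i).

Lemma weight_natE (k : nat) (i : 'I_k) : weight_nat k i = weight f i.
Proof. by rewrite /weight_nat valK. Qed.

Definition weight_gap (k i : nat) : R := weight_nat k i - weight_nat k i.+1.

Lemma weight_gap_ge0 (k i : nat) : (i.+1 < k)%N -> 0 <= weight_gap k i.
Proof.
move=> lt_ik; rewrite subr_ge0.
rewrite -[i.+1]/(val (Ordinal lt_ik)) -[i]/(val (Ordinal (ltnW lt_ik))).
by rewrite !weight_natE; apply: weight_noninc.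
Qed.

Lemma weight_gap_gt0 (k i : nat) :
  decreasing_weights f -> (i.+1 < k)%N -> 0 < weight_gap k i.
Proof.
move=> f_decr lt_ik; rewrite subr_gt0.
rewrite -[i.+1]/(val (Ordinal lt_ik)) -[i]/(val (Ordinal (ltnW lt_ik))).
by rewrite !weight_natE; apply: f_decr.
Qed.

(** The gaps of index at least [i] telescope to the weight at [i] minus the last weight. Having [i]
    in ['I_k] forces [k] to be positive, so [k.-1] is the last index. *)
Lemma weight_telescope (k : nat) (i : 'I_k) :
  weight f i =
  weight_nat k k.-1 + \sum_(j < k.-1 | (i <= j)%N) weight_gap k j.
Proof.
have le_ik : (i <= k.-1)%N by case: k i => [[]|k] // i; rewrite -ltnS ltn_ord.
rewrite -weight_natE -(big_mkord (fun j => i <= j)%N) /=.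
rewrite -(big_nat_widenl _ _ _ xpredT) //.
under eq_bigr do rewrite /weight_gap -opprB.
by rewrite sumrN telescope_sumr // opprB addrC subrK.
Qed.

Lemma score_abel p a :
  score f p a =
  weight_nat n n.-1 + \sum_(j < n.-1) weight_gap n j * cum_prob p j.+1 a.
Proof.
rewrite /score (eq_bigr (fun s : ranking A => p s * weight_nat n n.-1 +
    \sum_(j < n.-1 | (s a <= j)%N) p s * weight_gap n j)); last first.
  by move=> s _; rewrite weight_telescope mulrDr mulr_sumr.
rewrite big_split /= -mulr_suml profile_sum1 mul1r; congr (_ + _).
(* For fixed [j], the 0-based condition [s a <= j] is [pos s a <= j.+1], so the inner sum is a
   cumulative probability. *)
rewrite (exchange_big_dep xpredT) //=; apply: eq_bigr => j _.
by rewrite -mulr_suml mulrC.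
Qed.

Lemma cum_prob_card p a : cum_prob p n a = 1.
Proof. by rewrite -(profile_sum1 p); apply: eq_bigl => s; exact: ltn_ord. Qed.

Lemma pos_dom_ord p a b : pos_dom p a b ->
  forall j : 'I_n.-1, cum_prob p j.+1 b <= cum_prob p j.+1 a.
Proof. by move=> dom j; apply: dom; rewrite (leq_trans (ltn_ord j)) ?leq_pred. Qed.

Lemma pos_dom_score_le p a b : pos_dom p a b -> score f p b <= score f p a.
Proof.
move=> dom; rewrite !score_abel lerD2l; apply: ler_sum => j _.
apply: ler_wpM2l; last exact: pos_dom_ord.
by apply: weight_gap_ge0; rewrite -ltn_predRL.
Qed.

(** When [b] dominates [a], the score difference is a sum of nonnegative terms. If it is at most 0,
    each term vanishes, and positive gaps force equal cumulative probabilities. *)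
Lemma score_le_pos_dom p a b : decreasing_weights f ->
  pos_dom p b a -> score f p b <= score f p a -> pos_dom p a b.
Proof.
move=> f_decr dom.
pose D (j : 'I_n.-1) :=
  weight_gap n j * (cum_prob p j.+1 b - cum_prob p j.+1 a).
have gap_gt0 (j : 'I_n.-1) : 0 < weight_gap n j.
  by apply: weight_gap_gt0 => //; rewrite -ltn_predRL.
have D_ge0 j : true -> 0 <= D j.
  move=> _; apply: mulr_ge0; first exact: ltW.
  by rewrite subr_ge0; exact: pos_dom_ord.
rewrite !score_abel lerD2l -subr_le0 -sumrB => sum_le0.
have /psumr_eq0P D_eq0 : \sum_j D j = 0.
  apply/le_anti; rewrite sumr_ge0 // andbT.
  by under eq_bigr do rewrite /D mulrBr.
(* The Abel sum stops at position [n.-1]; at position [n] both cumulative probabilities are 1. *)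
case=> [//|j] /andP[_]; rewrite leq_eqVlt => /predU1P[->|lt_jn].
  by rewrite !cum_prob_card.
have lt_jn1 : (j < n.-1)%N by rewrite ltn_predRL.
have /eqP := D_eq0 D_ge0 (Ordinal lt_jn1) isT.
by rewrite /D mulf_eq0 (gt_eqF (gap_gt0 _)) subr_eq0 => /eqP ->.
Qed.

End Score.

Theorem corollary1 (R : realType) (X : choiceType)
    (Pi : permutation_process R X)
    (Pi_compat : strongly_pos_compatible Pi) (Pi_consistent : consistent Pi)
    (f : scoring_rule R) (f_decr : decreasing_weights f)
    (A : {fset X}) (A_neq0 : A != fset0) :
  winners f (Pi A) =
    [set a : A | forall b : A, pos_dom_process Pi (val a) (val b)].
Proof.
have [compat strong] := Pi_compat.
have [_ total] := compat setT.
apply/seteqP; split=> a /= win b; last first.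
  by apply: pos_dom_score_le; apply/(strong A A_neq0); exact: win.
(* If instead [b] dominates [a], the maximal score of [a] makes the dominance mutual. *)
case: (total (val a) (val b)) => // /(strong A A_neq0 b a) dom_ba.
by apply/(strong A A_neq0); exact: score_le_pos_dom (win b).
Qed.
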